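(* Let $(P,[\cdot,\cdot])$ be a smooth Leibniz manifold and let $A\subset\mathrm{Diff}_L(P)$ be a pseudogroup of local diffeomorphisms of $P$ such that the presheaf of $A$-invariant functions on $P$ is closed under the Leibniz bracket $[\cdot,\cdot]$. Let $S\subset P$ be a subset of $P$, endowed with a topology stronger than the relative topology, such that $W^{\infty}_{S/A_S}$ has the $(A,A_S)$-local extension property. Let $B_L^{\sharp},B_R^{\sharp}:T^{\ast}P\to TP$ be the left and right bundle maps associated to the Leibniz tensor of $(P,[\cdot,\cdot])$. Then $(P,[\cdot,\cdot],A,S)$ is Leibniz reducible if and only if for any $m\in S$ $$B_L^{\sharp}(\Delta_m)+B_R^{\sharp}(\Delta_m)\subset\left[\Delta_m^S\right]^{\circ},$$ where $$\Delta_m:=\{\mathbf{d}F(m)\mid F\in C^{\infty}_P(U_m)^A,\ \text{for any open } A\text{-invariant neighborhood } U_m \text{ of } m \text{ in } P\}$$ and $$\Delta_m^S:=\{\mathbf{d}F(m)\in\Delta_m\mid F|_{U_m\cap V_m}\text{ is constant, for an open } A\text{-invariant neighborhood } U_m \text{ of } m \text{ in } P \text{ and an open } A_S\text{-invariant neighborhood } V_m \text{ of } m \text{ in } S\}.$$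
   Context: **Leibniz manifolds.** A Leibniz manifold $(P,[\cdot,\cdot])$ is a smooth manifold $P$ with an $\mathbb{R}$-bilinear map $[\cdot,\cdot]$ on $C^{\infty}(P)$ that is a derivation in each entry: $[fg,h]=[f,h]g+f[g,h]$, $[f,gh]=g[f,h]+h[f,g]$ (no antisymmetry or Jacobi identity). The bracket depends only on first derivatives, so it restricts to $C^{\infty}_P(U)=C^\infty(U)$ for every open $U\subset P$, and there is a tensor $B$ with $B(\mathbf{d}f,\mathbf{d}g)=[f,g]$ (the Leibniz tensor). The bundle maps $B_L^{\sharp},B_R^{\sharp}:T^{\ast}P\to TP$ are defined by $B(\alpha,\beta)=-\langle\beta,B_L^{\sharp}(\alpha)\rangle$ and $B(\alpha,\beta)=\langle\alpha,B_R^{\sharp}(\beta)\rangle$. For a subset $E\subset T_m^{\ast}P$, $E^{\circ}\subset T_mP$ is its annihilator. **Pseudogroups.** $\mathrm{Diff}_L(P)$ is the monoid of local diffeomorphisms $F:\mathrm{Dom}(F)\to F(\mathrm{Dom}(F))$ between open subsets of $P$, with product $(G,\mathrm{Dom}(G))\cdot(F,\mathrm{Dom}(F)):=(G\circ F,F^{-1}(\mathrm{Dom}(G))\cap\mathrm{Dom}(F))$ and unit $(\mathbb{I},P)$. A pseudogroup is a submonoid $A$ such that for each $F:\mathrm{Dom}(F)\to F(\mathrm{Dom}(F))$ in $A$ the inverse $F^{-1}:F(\mathrm{Dom}(F))\to\mathrm{Dom}(F)$ is also in $A$. The orbit of $m\in P$ is $A\cdot m:=\{F(m)\mid F\in A,\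 m\in\mathrm{Dom}(F)\}$; orbits partition $P$, and $P/A$ is the orbit space with the quotient topology. A subset is $A$-invariant if it contains $a(z)$ whenever it contains $z$ and $a\in A$, $z\in\mathrm{Dom}(a)$; for $U$ open and $A$-invariant, $C^{\infty}_P(U)^A$ denotes the functions $F\in C^{\infty}(U)$ with $F(a(z))=F(z)$ for all $a\in A$, $z\in U\cap\mathrm{Dom}(a)$. The presheaf of $A$-invariant functions is closed under the bracket if $[F,G]\in C^\infty_P(U)^A$ for all $F,G\in C^{\infty}_P(U)^A$ and all such $U$. **The subset $S$.** $S\subset P$ carries a topology $\mathcal{T}$ stronger than (containing) the relative topology. $A_S:=\{a\in A\mid a(s)\in S\text{ for any }s\in S\cap\mathrm{Dom}(a)\}$, assumed to be a subpseudogroup of $A$. $\pi_S:S\to S/A_S$ is the projection onto the orbit space, with the quotient topology. The presheaf $W^{\infty}_{S/A_S}$ of Whitney smooth functions on $S/A_S$: for $V\subset S/A_S$ open, $f\in W^{\infty}_{S/A_S}(V)$ iff $f:V\to\mathbb{R}$ and for any $m\in\pi_S^{-1}(V)$ there exist an open $A_S$-invariant neighborhood $U_m$ of $m$ in $P$ and $F\in C^{\infty}_P(U_m)^{A_S}$ such that $f\circ\pi_S|_{\pi_S^{-1}(V)\cap U_m}=F|_{\pi_S^{-1}(V)\cap U_m}$. $W^{\infty}_{S/A_S}$ has the $(A,A_S)$-local extension property when $A_S$ is a subpseudogroup of $A$ and for any $f\in W^{\infty}_{S/A_S}(V)$ and $m\in\pi_S^{-1}(V)$ there exist an open $A$-invariant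 neighborhood $U_m$ of $m$ in $P$ and $F\in C^{\infty}_P(U_m)^A$ such that $f\circ\pi_S|_{\pi_S^{-1}(V)\cap U_m}=F|_{\pi_S^{-1}(V)\cap U_m}$; such an $F$ is called an $A$-invariant local extension of $f\circ\pi_S$ at $m$. **Leibniz reducibility.** A presheaf of Leibniz algebras on a topological space with a presheaf $\mathcal{F}$ of functions assigns to each open set $V$ a bilinear operation $\mathcal{F}(V)\times\mathcal{F}(V)\to\mathcal{F}(V)$ that is a derivation in each entry. $(P,[\cdot,\cdot],A,S)$ is Leibniz reducible when $(S/A_S,W^{\infty}_{S/A_S},[\cdot,\cdot]^{S/A_S})$ is a well defined presheaf of Leibniz algebras, where for any open $V\subset S/A_S$ the bracket $[\cdot,\cdot]^{S/A_S}_V:W^{\infty}_{S/A_S}(V)\times W^{\infty}_{S/A_S}(V)\to W^{\infty}_{S/A_S}(V)$ is given by $$[f,g]_V^{S/A_S}(\pi_S(m))=[F,G](m)$$ for any $m\in\pi_S^{-1}(V)$ and any $A$-invariant local extensions $F,G$ at $m$ of $f\circ\pi_S$ and $g\circ\pi_S$, respectively (well defined meaning in particular that the right-hand side is independent of the choices). *)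

(* Defs.v *)
From HB Require Import structures.
From mathcomp Require Import all_boot all_order all_algebra.
From mathcomp Require Import all_classical all_reals all_analysis.

Set Implicit Arguments.
Unset Strict Implicit.
Unset Printing Implicit Defensive.

Import Order.TTheory GRing.Theory Num.Theory.
Import numFieldNormedType.Exports.
Local Open Scope classical_set_scope.
Local Open Scope ring_scope.

(* In finite dimension, [f] is of class C^(k+1) on an open set iff it is
   Frechet differentiable there and all its directional derivatives are C^k. *)
Fixpoint Ck (R : realType) (V W : normedModType R) (k : nat) (U : set V)
    (f : V -> W) : Prop :=
  match k with
  | 0 => forall x, U x -> {for x, continuous f}
  | k.+1 => (forall x, U x -> differentiable f x) /\
            (forall v, Ck k U (fun x => 'D_v f x))
  end.

Definition Csmooth (R : realType) (V W : normedModType R) (U : set V)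
    (f : V -> W) : Prop := forall k, Ck k U f.

Section CkTheory.
Variables (R : realType) (V : normedModType R).

Lemma differentiable_near0 (W : normedModType R) (h : V -> W) (x : V) :
  (\near x, h x = 0) -> differentiable h x.
Proof.
move=> h0; have hx : h x = 0 by exact: (nbhs_singleton h0).
have E : h \o shift x = cst (h x) + (\0 : {linear V -> W}) +o_ (0 : V) id.
  apply/eqaddoP => _/posnumP[e]; rewrite near_simpl /=.
  have : \forall y \near (0 : V), h (y + x) = 0.
    by move: h0; rewrite (near_shift 0) /= subr0.
  apply: filterS => y /= hy.
  rewrite fctE /= hy hx; do ?rewrite fctE /=.
  by rewrite addr0 subrr normr0 mulr_ge0.
have c0 : continuous (\0 : {linear V -> W}) by move=> z; exact: cvg_cst.
have dE := diff_unique c0 E.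
by apply/diff_locallyP; rewrite dE.
Qed.

Lemma near_eq_differentiable (W : normedModType R) (f g : V -> W) (x : V) :
  (\near x, f x = g x) -> differentiable f x -> differentiable g x.
Proof.
move=> fg df.
have -> : g = f + (g - f) by apply/funext => y; rewrite !fctE addrC subrK.
apply: differentiableD => //; apply: differentiable_near0.
by apply: filterS fg => y; rewrite !fctE => ->; rewrite subrr.
Qed.

Lemma Ck_ext (W : normedModType R) k (U : set V) (f g : V -> W) :
  open U -> (forall x, U x -> f x = g x) -> Ck k U f -> Ck k U g.
Proof.
move=> oU.
have near_fg (f' g' : V -> W) : (forall x, U x -> f' x = g' x) ->
    forall x, U x -> \near x, f' x = g' x.
  move=> fg x Ux; have := open_nbhs_nbhs (conj oU Ux).
  by apply: filterS => y; exact: fg.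
elim: k f g => [|k IH] f g fg /=.
- move=> cf x Ux; rewrite /prop_for /continuous_at -fg//.
  apply: cvg_trans (cf x Ux); apply: near_eq_cvg.
  exact: near_fg fg x Ux.
- move=> [df Df]; split=> [x Ux|v].
    by apply: near_eq_differentiable (df x Ux); exact: near_fg fg x Ux.
  apply: IH (Df v) => x Ux; apply: near_eq_derive; exact: near_fg fg x Ux.
Qed.

Lemma CkS (W : normedModType R) k (U : set V) (f : V -> W) :
  Ck k.+1 U f -> Ck k U f.
Proof.
elim: k f => [|k IH] f /= [df Df].
  by move=> x Ux; apply: differentiable_continuous; exact: df.
by split=> // v; apply: IH; exact: Df.
Qed.

Lemma Ck_cst (W : normedModType R) k (U : set V) (c : W) : Ck k U (fun=> c).
Proof.
elim: k c => [|k IH] c /=; first by move=> x _; exact: cvg_cst.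
split=> [x _|v]; first exact: differentiable_cst.
have -> : (fun x => 'D_v (fun=> c) x) = (fun=> 0 : W).
  by apply/funext => x; rewrite derive_cst.
exact: IH.
Qed.

Lemma CkD (W : normedModType R) k (U : set V) (f g : V -> W) :
  open U -> Ck k U f -> Ck k U g -> Ck k U (f + g).
Proof.
move=> oU; elim: k f g => [|k IH] f g /=.
  by move=> cf cg x Ux; apply: continuousD; [exact: cf|exact: cg].
move=> [df Df] [dg Dg]; split=> [x Ux|v].
  by apply: differentiableD; [exact: df|exact: dg].
apply: (Ck_ext (f := (fun x => 'D_v f x) + (fun x => 'D_v g x))) => //.
  move=> x Ux; rewrite deriveD//; apply: diff_derivable; [exact: df|exact: dg].
exact: IH.
Qed.

Lemma CkM k (U : set V) (f g : V -> R) :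
  open U -> Ck k U f -> Ck k U g -> Ck k U (f * g).
Proof.
move=> oU; elim: k f g => [|k IH] f g.
  by move=> cf cg x Ux; have := @continuousM _ _ f g x (cf x Ux) (cg x Ux).
move=> Cf Cg; have := Cf; have := Cg => -[dg Dg] [df Df].
split=> [x Ux|v].
  by apply: differentiableM; [exact: df|exact: dg].
apply: (Ck_ext (f := f * (fun x => 'D_v g x) + g * (fun x => 'D_v f x))) => //.
  by move=> x Ux; rewrite deriveM//; apply: diff_derivable; [exact: df|exact: dg].
apply: CkD => //; apply: IH; first exact: CkS.
- exact: Dg.
- exact: CkS.
- exact: Df.
Qed.

End CkTheory.

Section Manifold.
Variables (R : realType) (n : nat).

(* [chart_map] and [chart_inv] are meaningful on [chart_dom] and on
   [chart_map @` chart_dom] only. *)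
Record chart (P : topologicalType) := Chart {
  chart_dom : set P ;
  chart_map : P -> 'rV[R]_n ;
  chart_inv : 'rV[R]_n -> P ;
  chart_open_dom : open chart_dom ;
  chart_open_img : open (chart_map @` chart_dom) ;
  chart_mapK : forall x, chart_dom x -> chart_inv (chart_map x) = x ;
  chart_map_cont : {within chart_dom, continuous chart_map} ;
  chart_inv_cont : {within chart_map @` chart_dom, continuous chart_inv} }.

Record smooth_manifold := SmoothManifold {
  manifold_sort :> topologicalType ;
  manifold_hausdorff : hausdorff_space manifold_sort ;
  manifold_second_countable : @second_countable manifold_sort ;
  atlas : set (chart manifold_sort) ;
  atlas_cover : forall x, exists2 c, atlas c & chart_dom c x ;
  atlas_compat : forall c d, atlas c -> atlas d ->
    Csmooth (chart_map c @` (chart_dom c `&` chart_dom d))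
            (chart_map d \o chart_inv c) }.

End Manifold.

Section SmoothFunctions.
Variables (R : realType) (n : nat) (P : smooth_manifold R n).

(* A function on the open set [U] is a total function whose values outside
   [U] are irrelevant. *)
Definition smooth_on (U : set P) (F : P -> R) : Prop :=
  forall c, atlas c ->
    Csmooth (chart_map c @` (chart_dom c `&` U)) (F \o chart_inv c).

Definition smooth_pred : {pred P -> R} := fun F => `[< smooth_on setT F >].

Lemma smooth_cst (a : R) : (fun=> a) \in smooth_pred.
Proof. by apply/asboolP => c _ k; exact: Ck_cst. Qed.

Let open_img (c : chart R n P) : open (chart_map c @` (chart_dom c `&` setT)).
Proof. by rewrite setIT; exact: chart_open_img. Qed.

Lemma smooth_add f g :
  f \in smooth_pred -> g \in smooth_pred -> f + g \in smooth_pred.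
Proof.
move=> /asboolP sf /asboolP sg; apply/asboolP => c ac k.
exact: (@CkD _ _ _ k _ (f \o chart_inv c) (g \o chart_inv c) (@open_img c)
  (sf c ac k) (sg c ac k)).
Qed.

Lemma smooth_mul f g :
  f \in smooth_pred -> g \in smooth_pred -> f * g \in smooth_pred.
Proof.
move=> /asboolP sf /asboolP sg; apply/asboolP => c ac k.
exact: (@CkM _ _ k _ (f \o chart_inv c) (g \o chart_inv c) (@open_img c)
  (sf c ac k) (sg c ac k)).
Qed.

Lemma smooth_scale (a : R) f : f \in smooth_pred -> a *: f \in smooth_pred.
Proof. by move=> sf; exact: smooth_mul (smooth_cst a) sf. Qed.

Lemma smooth_subring_closed : subring_closed smooth_pred.
Proof.
split; [exact: (smooth_cst 1)| |exact: smooth_mul].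
move=> f g sf sg; rewrite -[- g]scaleN1r.
by apply: smooth_add => //; exact: smooth_scale.
Qed.

HB.instance Definition _ :=
  GRing.isSubringClosed.Build (P -> R) smooth_pred smooth_subring_closed.
HB.instance Definition _ :=
  GRing.isScaleClosed.Build R (P -> R) smooth_pred smooth_scale.

Record smoothfun := SmoothFun {
  smooth_fun :> P -> R ; _ : smooth_fun \in smooth_pred }.
HB.instance Definition _ := [isSub for smooth_fun].
HB.instance Definition _ := [Choice of smoothfun by <:].
HB.instance Definition _ := GRing.SubChoice_isSubComPzRing.Build (P -> R)
  smooth_pred smoothfun smooth_subring_closed.
HB.instance Definition _ := [SubZmodule_isSubLmodule of smoothfun by <:].
End SmoothFunctions.

Section TangentSpaces.
Variables (R : realType) (n : nat) (P : smooth_manifold R n).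

Definition derivation_at (m : P) : {pred smoothfun P -> R} := fun v =>
  `[< linear (v : smoothfun P -> R^o) /\
      forall f g, v (f * g) = v f * g m + f m * v g >].

Lemma derivation_at_submod_closed m : submod_closed (derivation_at m).
Proof.
split=> [|a v w /asboolP[lv Lv] /asboolP[lw Lw]]; apply/asboolP.
  have E0 h : (0 : smoothfun P -> R) h = 0 by [].
  by split=> [b f g|f g]; rewrite !E0 ?scaler0 ?mul0r ?mulr0 addr0.
have E h : (a *: v + w) h = a * v h + w h by [].
split=> [b f g|f g]; rewrite !E ?lv ?lw ?Lv ?Lw.
  by rewrite scalerDr mulrDr addrACA [in RHS]/GRing.scale /= mulrCA.
by rewrite !mulrDl !mulrDr !mulrA [f m * a]mulrC addrACA.
Qed.
HB.instance Definition _ m :=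
  GRing.isSubmodClosed.Build R (smoothfun P -> R)
    (derivation_at m) (derivation_at_submod_closed m).

Record tangent (m : P) := Tangent {
  tangent_fun :> smoothfun P -> R ; _ : tangent_fun \in derivation_at m }.
HB.instance Definition _ m := [isSub for @tangent_fun m].
HB.instance Definition _ m := [Choice of tangent m by <:].
HB.instance Definition _ m := [SubChoice_isSubLmodule of tangent m by <:].

(* The linear forms on the (finite-dimensional) tangent space at [m] are the
   differentials at [m] of smooth functions. *)
Record cotangent (m : P) := Cotangent {
  cotangent_fun :> tangent m -> R ;
  cotangentP : exists f : smoothfun P,
    cotangent_fun = (fun v : tangent m => v f) }.

(* A function that is smooth near [m] coincides near [m] with a globally
   defined smooth function. *)
Definition global_ext (m : P) (F : P -> R) : smoothfun P :=
  xget 0 [set f : smoothfun P | \forall z \near m, f z = F z].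

Definition differential (m : P) (F : P -> R) : cotangent m :=
  Cotangent (ex_intro _ (global_ext m F) erefl).

Definition primitive (m : P) (alpha : cotangent m) : smoothfun P :=
  sval (cid (cotangentP alpha)).

Definition annihilator (m : P) (E : set (cotangent m)) : set (tangent m) :=
  [set v | forall alpha, E alpha -> alpha v = 0].

End TangentSpaces.

Section LeibnizManifold.
Variables (R : realType) (n : nat) (P : smooth_manifold R n).

Record leibniz_bracket := LeibnizBracket {
  lbracket :> smoothfun P -> smoothfun P -> smoothfun P ;
  lbracket_linearl : forall h, linear (lbracket^~ h) ;
  lbracket_linearr : forall h, linear (lbracket h) ;
  lbracket_derl : forall f g h,
    lbracket (f * g) h = lbracket f h * g + f * lbracket g h ;
  lbracket_derr : forall f g h,
    lbracket f (g * h) = g * lbracket f h + h * lbracket f g }.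

Variable br : leibniz_bracket.

(* The restriction of the bracket to open subsets: [F] and [G] need only be
   smooth near the points at which [local_bracket F G] is evaluated. *)
Definition local_bracket (F G : P -> R) : P -> R :=
  fun m => br (global_ext m F) (global_ext m G) m.

Definition leibniz_tensor (m : P) (alpha beta : cotangent m) : R :=
  br (primitive alpha) (primitive beta) m.

(* The vector is unique: [v f] is the value at [v] of the differential of [f],
   so covectors separate tangent vectors. *)
Definition BL (m : P) (alpha : cotangent m) : tangent m :=
  xget 0 [set v | forall beta, leibniz_tensor alpha beta = - beta v].

Definition BR (m : P) (beta : cotangent m) : tangent m :=
  xget 0 [set v | forall alpha, leibniz_tensor alpha beta = alpha v].

End LeibnizManifold.

(* Partially defined maps are encoded as maps [P -> option P], with value
   [None] outside of the domain. *)
Section Pseudogroups.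
Variables (R : realType) (n : nat) (P : smooth_manifold R n).
Implicit Types (a b : P -> option P) (A : set (P -> option P)).

Definition pinverse a b : Prop := forall z w, a z = Some w <-> b w = Some z.

Definition ppreimage a (W : set P) : set P :=
  [set z | exists2 w, W w & a z = Some w].

(* The domain of [a], [ppreimage a setT], is open. *)
Definition psmooth a : Prop :=
  (forall W, open W -> open (ppreimage a W)) /\
  forall c d, atlas c -> atlas d ->
    Csmooth (chart_map c @` (chart_dom c `&` ppreimage a (chart_dom d)))
            (fun x => oapp (chart_map d) 0 (a (chart_inv c x))).

Definition local_diffeo a : Prop :=
  exists b, [/\ pinverse a b, psmooth a & psmooth b].

Definition pcomp a b : P -> option P := fun z => obind a (b z).

Record pseudogroup A : Prop := Pseudogroup {
  pg_diffeo : forall a, A a -> local_diffeo a ;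
  pg_id : A Some ;
  pg_comp : forall a b, A a -> A b -> A (pcomp a b) ;
  pg_inv : forall a b, A a -> pinverse a b -> A b }.

Definition orbit A (m : P) : set P := [set z | exists2 a, A a & a m = Some z].

Definition invariant_set A (U : set P) : Prop :=
  forall a z w, A a -> U z -> a z = Some w -> U w.

Definition inv_nbhs A (m : P) (U : set P) : Prop :=
  [/\ open U, invariant_set A U & U m].

Definition inv_smooth A (U : set P) (F : P -> R) : Prop :=
  smooth_on U F /\
  forall a z w, A a -> U z -> a z = Some w -> F w = F z.

Definition invariants_closed (br : leibniz_bracket P) A : Prop :=
  forall U, open U -> invariant_set A U ->
  forall F G, inv_smooth A U F -> inv_smooth A U G ->
    inv_smooth A U (local_bracket br F G).

End Pseudogroups.

Section Reduction.
Variables (R : realType) (n : nat) (P : smooth_manifold R n).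
Variables (A : set (P -> option P)) (S : set P) (T : set (set P)).

(* [T] is the collection of open sets of a topology on [S]. *)
Definition topology_on : Prop :=
  [/\ forall W, T W -> W `<=` S,
      T S,
      forall W W', T W -> T W' -> T (W `&` W') &
      forall F : set (set P), F `<=` T -> T (\bigcup_(W in F) W)].

Definition stronger_than_relative : Prop := forall U, open U -> T (U `&` S).

(* The subset A_S of [A]. *)
Definition stab : set (P -> option P) :=
  [set a | A a /\ forall s w, S s -> a s = Some w -> S w].

(* A point of the orbit space [S / A_S] is an orbit, i.e. a set of points. *)
Definition proj (m : P) : set P := orbit stab m.

Definition orbit_space : set (set P) := proj @` S.

Definition proj_preimage (V : set (set P)) : set P := S `&` proj @^-1` V.

Definition orbit_open (V : set (set P)) : Prop :=
  V `<=` orbit_space /\ T (proj_preimage V).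

Definition at_orbit (V : set (set P)) (q : set P) (Vq : V q) : V :=
  exist _ q (mem_set Vq).

Definition local_extension (A' : set (P -> option P)) (V : set (set P))
    (f : V -> R) (m : P) (U : set P) (F : P -> R) : Prop :=
  [/\ inv_nbhs A' m U, inv_smooth A' U F &
      forall z, S z -> U z -> forall Vz : V (proj z), f (at_orbit Vz) = F z].

Definition whitney (V : set (set P)) : set (V -> R) :=
  [set f | forall m, proj_preimage V m ->
             exists U F, local_extension stab f m U F].

Definition local_extension_property : Prop :=
  pseudogroup stab /\
  forall V, orbit_open V -> forall f, whitney f ->
  forall m, proj_preimage V m -> exists U F, local_extension A (V := V) f m U F.

Record leibniz_presheaf
    (b : forall V : set (set P), (V -> R) -> (V -> R) -> (V -> R)) : Prop := {
  lp_whitney : forall V, orbit_open V -> forall f g,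
    whitney f -> whitney g -> whitney (b V f g) ;
  lp_linearl : forall V, orbit_open V -> forall (k : R) f f' g,
    whitney f -> whitney f' -> whitney g ->
    b V (k *: f + f') g = k *: b V f g + b V f' g ;
  lp_linearr : forall V, orbit_open V -> forall (k : R) f g g',
    whitney f -> whitney g -> whitney g' ->
    b V f (k *: g + g') = k *: b V f g + b V f g' ;
  lp_derl : forall V, orbit_open V -> forall f g h,
    whitney f -> whitney g -> whitney h ->
    b V (f * g) h = b V f h * g + f * b V g h ;
  lp_derr : forall V, orbit_open V -> forall f g h,
    whitney f -> whitney g -> whitney h ->
    b V f (g * h) = g * b V f h + h * b V f g }.

Variable br : leibniz_bracket P.

Definition leibniz_reducible : Prop :=
  exists b : forall V : set (set P), (V -> R) -> (V -> R) -> (V -> R),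
    leibniz_presheaf b /\
    forall V, orbit_open V -> forall f g, whitney f -> whitney g ->
    forall m, S m -> forall Vm : V (proj m),
    forall U F U' G,
      local_extension A f m U F -> local_extension A g m U' G ->
      b V f g (at_orbit Vm) = local_bracket br F G m.

Definition Delta (m : P) : set (cotangent m) :=
  [set alpha | exists U F,
     [/\ inv_nbhs A m U, inv_smooth A U F & alpha = differential m F]].

Definition DeltaS (m : P) : set (cotangent m) :=
  [set alpha | exists U F V,
     [/\ inv_nbhs A m U, inv_smooth A U F, alpha = differential m F,
         [/\ T V, invariant_set stab V & V m] &
         exists c : R, forall z, U z -> V z -> F z = c]].

End Reduction.

Arguments Delta {R n P} A m.
Arguments DeltaS {R n P} A S T m.
Arguments BL {R n P} br m alpha.
Arguments BR {R n P} br m beta.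

(* Main.v *)
Require Import Defs.
From HB Require Import structures.
From mathcomp Require Import all_boot all_order all_algebra.
From mathcomp Require Import all_classical all_reals all_analysis.
From mathcomp Require Import ring lra.
Import Order.TTheory GRing.Theory Num.Theory.
Import numFieldNormedType.Exports.
Set Implicit Arguments.
Unset Strict Implicit.
Unset Printing Implicit Defensive.
Local Open Scope classical_set_scope.
Local Open Scope ring_scope.

(** Whether the reduced bracket exists is decided point by point.  Contracting
with differentials gives [dH (BL dF) = - [F, H]] and [dH (BR dF) = [H, F]];
as constants have zero bracket with everything, 0 belongs to both images, so
the inclusion at [m] says exactly that [F, H] and [H, F] vanish at [m] for
every invariant [F] and every invariant [H] that is constant on a
neighbourhood of [m] in [S] ([annihilator_bracket]).

If these brackets vanish, two invariant local extensions of the same function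
on the quotient differ by an invariant function that is zero on an open
saturated part of [S]; by bilinearity the value of the bracket does not depend
on the extensions ([local_bracket_unique]).  It does not depend on the point of
the orbit either, since the bracket of invariant functions is invariant
([reduced_bracketE]).  The bracket of two extensions is itself invariant and
extends the reduced bracket, which is therefore a Whitney smooth function, and
the algebraic identities descend from those on the manifold
([reducible_of_annihilates]).

Conversely, let [H] be equal to [c] on [V], open in [S] and saturated.  On the
quotient of the part of [V] where [F] and [H] are both defined, [H] and the
constant [c] extend the same function, so reducibility forces
[F, H] = [F, c] = 0 at [m], and likewise [H, F] = 0
([annihilates_of_reducible]).

All this presupposes that the bracket acts on germs: every function that is
smooth near [m] must agree near [m] with a global smooth function
([global_extP]), and a derivation at [m] must depend on germs only
([tangent_local]).  Both follow from bump functions, which are built from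
[exp (-1/x)] composed with the squared distance in a chart ([smooth_bump]). *)

(** * A flat function on the real line *)

(** The function [x^-N exp (-1/x)], extended by 0 to the left of 0.  Letting [N]
vary makes the family stable under differentiation, up to linear
combinations; this is what makes smoothness a plain induction. *)
Definition flat (R : realType) (N : nat) (x : R) : R :=
  if 0 < x then x^-1 ^+ N * expR (- x^-1) else 0.

(** The quadratic bound gives the zero derivative at 0.  It comes from
[exp y = (exp (y / M)) ^ M >= (y / M) ^ M] with [M = N + 2] and [y = 1/x]. *)
Lemma flat_bound (R : realType) (N : nat) (x : R) :
  0 < x -> flat N x <= (N.+2)%:R ^+ N.+2 * x ^+ 2.
Proof.
move=> x0; rewrite /flat x0 expRN.
have M0 : (0 : R) < (N.+2)%:R by [].
have y0 : 0 < x^-1 by rewrite invr_gt0.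
have h : (x^-1 / (N.+2)%:R) ^+ N.+2 <= expR x^-1.
  have -> : expR x^-1 = expR (x^-1 / (N.+2)%:R) ^+ N.+2.
    by rewrite -expRM_natl mulrC mulfVK ?gt_eqF.
  apply: lerXn2r; rewrite ?nnegrE ?expR_ge0 ?divr_ge0// ?ltW//.
  by apply: lt_le_trans (expR_ge1Dx _); rewrite ltrDr.
have h2 : (expR x^-1)^-1 <= ((x^-1 / (N.+2)%:R) ^+ N.+2)^-1.
  by rewrite lef_pV2 ?posrE ?expR_gt0// exprn_gt0// divr_gt0.
apply: le_trans (ler_wpM2l _ h2) _; first by rewrite exprn_ge0// ltW.
rewrite -exprVn invf_div invrK exprMn mulrCA.
have -> // : x^-1 ^+ N * x ^+ N.+2 = x ^+ 2.
by rewrite -(addn2 N) exprD mulrA -exprMn mulVf ?gt_eqF// expr1n mul1r.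
Qed.

Lemma flat_is_derive (R : realType) (N : nat) (x : R) :
  is_derive x 1 (flat N : R -> R) (flat N.+2 x - N%:R * flat N.+1 x).
Proof.
case: (ltgtP x 0) => [x0|x0|->].
- rewrite [flat N.+2 _]/flat [flat N.+1 _]/flat !(lt_gtF x0) mulr0 subr0.
  apply: (@near_eq_is_derive _ _ _ (cst 0)).
  have := lt_nbhsl x0; apply: filterS => y y0.
  by rewrite /flat lt_gtF.
- have xn0 : x != 0 by rewrite gt_eqF.
  pose inv := fun y : R => (id y)^-1.
  have di : is_derive x 1 inv (- (x ^- 2)).
    have := @is_deriveV R id x 1 1 xn0 (is_derive_id _ _).
    by rewrite /= [_%:A]mulr1.
  have de : is_derive x 1 (expR \o (- inv)) (expR (- x^-1) * x ^- 2).
    have := @is_derive1_comp R expR (- inv) x _ _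
      (is_derive_expR _) (is_deriveN di).
    by rewrite opprK.
  have := is_deriveM (is_deriveX N di) de.
  rewrite /= /inv /GRing.scale /= => d.
  set D := (X in is_derive _ _ _ X) in d.
  have -> : flat N.+2 x - N%:R * flat N.+1 x = D.
    have opp_inv : (- [eta @GRing.inv R]) x = - x^-1 by [].
    rewrite /D exprfctE opp_inv /flat x0 -!exprVn.
    case: (N) => [|k]; first by rewrite expr0; ring.
    by rewrite /= !exprS; ring.
  apply: (near_eq_is_derive _ d).
  have := lt_nbhsr x0; apply: filterS => y y0.
  change (([eta @GRing.inv R] ^+ N) y * expR (- y^-1) = flat N y).
  by rewrite exprfctE /flat y0.
- rewrite [flat N.+2 _]/flat [flat N.+1 _]/flat ltxx mulr0 subr0.
  pose C : R := N.+2%:R ^+ N.+2.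
  have C0 : 0 < C + 1 by rewrite ltr_wpDl// exprn_ge0.
  have cv : (fun h : R =>
      h^-1 *: ((flat N \o shift (0 : R)) (h *: (1 : R))
        - flat N (0 : R))) @ 0^' --> (0 : R).
    apply/cvgr0Pnorm_lt => e e0.
    have he : \forall h \near (0 : R)^', `|h| < e / (C + 1).
      apply: cvg_within; exists (e / (C + 1)) => /=; first exact: divr_gt0.
      by move=> y /=; rewrite sub0r normrN.
    have hn : \forall h \near (0 : R)^', h != 0 by exact: nbhs_dnbhs_neq.
    apply: filterS2 he hn => h he hn.
    rewrite /= addr0 [h%:A]mulr1 [flat N 0]/flat ltxx subr0 [_ *: _]mulrC.
    have [h0|h0|h0] := ltgtP h 0.
    + by rewrite /flat (lt_gtF h0) mul0r normr0.
    + rewrite ger0_norm; last first.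
        by rewrite /flat h0 !mulr_ge0 ?expR_ge0 ?exprn_ge0 ?invr_ge0// ltW.
      rewrite ltr_pdivrMr//; apply: le_lt_trans (flat_bound N h0) _.
      rewrite expr2 mulrA ltr_pM2r// -/C.
      move: he; rewrite gtr0_norm// ltr_pdivlMr// => he.
      by apply: le_lt_trans he; rewrite mulrDr mulr1 mulrC lerDl ltW.
    + by rewrite h0 eqxx in hn.
  by apply: DeriveDef; [apply: cvgP cv | apply: cvg_lim cv].
Qed.

(** * Calculus of functions of class C^k *)

Lemma Ck_subset (R : realType) (V W : normedModType R) (k : nat)
    (U U' : set V) (f : V -> W) : U' `<=` U -> Ck k U f -> Ck k U' f.
Proof.
move=> sU; elim: k f => [|k IH] f /=; first by move=> cf x /sU; exact: cf.
by move=> [df Df]; split=> [x /sU|v]; [exact: df|exact: IH].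
Qed.

(** Being of class C^k is a pointwise condition on all the successive directional
derivatives, which do not refer to the domain. *)
Lemma Ck_setU (R : realType) (V W : normedModType R) (k : nat)
    (U U' : set V) (f : V -> W) :
  Ck k U f -> Ck k U' f -> Ck k (U `|` U') f.
Proof.
elim: k f => [|k IH] f /=; first by move=> cf cf' x [/cf|/cf'].
by move=> [df Df] [df' Df']; split=> [x [/df|/df']|v] //; exact: IH.
Qed.

Lemma Ck_id (R : realType) (V : normedModType R) (k : nat) (U : set V) :
  Ck k U (id : V -> V).
Proof.
case: k => [|k]; first by move=> x _; exact: cvg_id.
split=> [x _|v]; first by [].
rewrite (_ : (fun x => _) = fun=> v); first exact: Ck_cst.
by apply/funext => x; rewrite derive_id.
Qed.

(** With a real function on the outside, the chain rule reads
[D_v (g o u) = D_v u * (g' o u)], and the induction closes through [CkM]. *)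
Lemma Ck_comp (R : realType) (V : normedModType R) (k : nat) (U : set V)
    (g : R -> R) (u : V -> R) :
  open U -> Ck k setT g -> Ck k U u -> Ck k U (g \o u).
Proof.
move=> oU; elim: k g u => [|k IH] g u.
  by move=> cg cu x Ux; apply: continuous_comp; [exact: cu|exact: cg].
move=> Cg Cu; have [dg Dg] := Cg; have [du Du] := Cu.
split=> [x Ux|v]; first by apply: differentiable_comp; [exact: du|exact: dg].
apply: (@Ck_ext _ _ _ _ _ ((fun x => 'D_v u x) * ((fun y => 'D_1 g y) \o u))) => //.
  move=> x Ux; rewrite [RHS]deriveE; last first.
    by apply: differentiable_comp; [exact: du|exact: dg].
  rewrite diff_comp; [|exact: du|exact: dg].
  have dgu : 'd g (u x) ('D_v u x) = 'D_v u x * 'd g (u x) (1 : R).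
    have := linearZ_LR ('d g (u x)) ('D_v u x) 1.
    by rewrite [_%:A]mulr1.
  by rewrite /= -(deriveE v (du x Ux)) dgu -(deriveE (1 : R) (dg (u x) I)).
apply: CkM => //; first exact: Du.
by apply: IH; [exact: Dg|exact: CkS].
Qed.

(** A coordinate is a continuous linear form, so it commutes with directional
derivatives. *)
Lemma Ck_coord (R : realType) (V : normedModType R) (n k : nat) (U : set V)
    (f : V -> 'rV[R]_n) (i : 'I_n) :
  open U -> Ck k U f -> Ck k U (fun x => f x 0 i).
Proof.
move=> oU; elim: k f => [|k IH] f.
  move=> cf x Ux.
  by apply: (@continuous_comp _ _ _ f (fun M : 'rV[R]_n => M 0 i));
    [exact: cf|exact: coord_continuous].
pose p := (fun M : 'rV[R]_n => M 0 i).
have lp : linear p by move=> a M M'; rewrite /p !mxE.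
pose lin_p := GRing.isLinear.Build _ _ _ _ p lp.
pose pL : {linear 'rV[R]_n -> R} := HB.pack p lin_p.
have dp M : differentiable pL M by exact: differentiable_coord.
have diffp M : 'd pL M = pL :> (_ -> _).
  by apply: diff_lin; exact: coord_continuous.
move=> [df Df]; split=> [x Ux|v].
  by apply: (@differentiable_comp _ _ _ _ f pL); [exact: df|exact: dp].
apply: Ck_ext (IH _ (Df v)) => // x Ux.
rewrite [RHS]deriveE; last first.
  by apply: (@differentiable_comp _ _ _ _ f pL); [exact: df|exact: dp].
by rewrite (@diff_comp _ _ _ _ f pL)//= ?diffp ?deriveE//; exact: df.
Qed.

Lemma Ck_sum (R : realType) (V : normedModType R) (k : nat) (U : set V)
    (I : Type) (s : seq I) (f : I -> V -> R) :
  open U -> (forall i, Ck k U (f i)) -> Ck k U (fun x => \sum_(i <- s) f i x).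
Proof.
move=> oU Cf; elim: s => [|i s IH].
  rewrite (_ : (fun x => _) = fun=> 0); first exact: Ck_cst.
  by apply/funext => x; rewrite big_nil.
rewrite (_ : (fun x => _) = f i + (fun x => \sum_(j <- s) f j x)); first exact: CkD.
by apply/funext => x; rewrite big_cons.
Qed.

Lemma Ck_flat (R : realType) (k N : nat) : Ck k setT (@flat R N : R -> R).
Proof.
elim: k N => [|k IH] N.
  move=> x _; apply: differentiable_continuous; apply/derivable1_diffP.
  by have [] := flat_is_derive N x.
have df x : differentiable (@flat R N : R -> R) x.
  by apply/derivable1_diffP; have [] := flat_is_derive N x.
split=> // v.
have -> : (fun x => 'D_v (@flat R N) x) =
    cst v * (flat N.+2 + cst (- N%:R) * flat N.+1).
  apply/funext => x; rewrite deriveE//.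
  have := linearZ_LR ('d (@flat R N) x) v 1; rewrite /GRing.scale /= mulr1 => ->.
  rewrite -deriveE//; have [_ ->] := flat_is_derive N x.
  by rewrite !fctE mulNr.
have oT : open (setT : set R) by exact: openT.
apply: CkM => //; first exact: Ck_cst.
apply: CkD => //; apply: CkM => //; exact: Ck_cst.
Qed.

(** The witness is [e (1 - e (t - a) / e (b - a)) / e 1] for [e = flat 0]: the
inner [e] vanishes up to [a] and, being increasing, exceeds [e (b - a)] from
[b] on, which makes the outer argument nonpositive. *)
Lemma smooth_step (R : realType) (a b : R) : a < b ->
  exists g : R -> R, [/\ Csmooth setT g,
    forall t, t <= a -> g t = 1 & forall t, b <= t -> g t = 0].
Proof.
move=> ab.
have flat_gt0 (x : R) : 0 < x -> 0 < flat 0 x.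
  by move=> x0; rewrite /flat x0 mul1r expR_gt0.
have flat_eq0 (x : R) : x <= 0 -> flat 0 x = 0.
  by move=> x0; rewrite /flat ltNge x0.
have c0 : 0 < flat 0 (b - a) by rewrite flat_gt0// subr_gt0.
have d0 : 0 < flat 0 (1 : R) by exact: flat_gt0.
exists (fun t => (flat 0 1)^-1 * flat 0 (1 - (flat 0 (b - a))^-1 * flat 0 (t - a))).
split=> [k|t ta|t bt].
- have oT : open (setT : set R) by exact: openT.
  pose s : R -> R :=
    cst 1 + cst (- (flat 0 (b - a))^-1) * (flat 0 \o (id + cst (- a))).
  have Cs : Ck k setT s.
    apply: CkD => //; first exact: Ck_cst.
    apply: CkM => //; first exact: Ck_cst.
    apply: Ck_comp => //; first exact: Ck_flat.
    by apply: CkD => //; [exact: Ck_id|exact: Ck_cst].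
  have -> : (fun t : R =>
      (flat 0 1)^-1 * flat 0 (1 - (flat 0 (b - a))^-1 * flat 0 (t - a))) =
      cst (flat 0 1)^-1 * (flat 0 \o s).
    by apply/funext => t; rewrite /s !fctE /= mulNr.
  apply: CkM => //; first exact: Ck_cst.
  by apply: Ck_comp => //; exact: Ck_flat.
- by rewrite [flat 0 (t - a)]flat_eq0 ?subr_le0// mulr0 subr0 mulVf// gt_eqF.
- rewrite [X in _ * X]flat_eq0 ?mulr0// subr_le0 ler_pdivlMl// mulr1.
  rewrite /flat !subr_gt0 ab (lt_le_trans ab bt) !mul1r ler_expR lerN2.
  by rewrite lef_pV2 ?posrE ?subr_gt0// ?(lt_le_trans ab bt)// lerD2r.
Qed.

(** * Bump functions and extension of germs *)

Lemma chart_map_continuous (R : realType) (n : nat) (P : smooth_manifold R n)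
    (c : chart R n P) (x : P) :
  chart_dom c x -> {for x, continuous (chart_map c)}.
Proof.
move=> Dx; have := chart_map_cont (c := c).
by rewrite continuous_open_subspace; [apply; rewrite inE|exact: chart_open_dom].
Qed.

Lemma chart_inv_continuous (R : realType) (n : nat) (P : smooth_manifold R n)
    (c : chart R n P) (x : P) :
  chart_dom c x -> {for chart_map c x, continuous (chart_inv c)}.
Proof.
move=> Dx; have := chart_inv_cont (c := c).
rewrite continuous_open_subspace; last exact: chart_open_img.
by apply; rewrite inE; exists x.
Qed.

(** The sets on which [smooth_on] tests a function are open, which the rules for
sums and products of C^k functions require. *)
Lemma open_chart_image (R : realType) (n : nat) (P : smooth_manifold R n)
    (c : chart R n P) (U : set P) :
  open U -> open (chart_map c @` (chart_dom c `&` U)).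
Proof.
move=> oU; rewrite openE => _ [x [Dx Ux] <-].
have Ix : nbhs (chart_map c x) (chart_map c @` chart_dom c).
  by apply: open_nbhs_nbhs; split; [exact: chart_open_img|exists x].
have Jx : nbhs (chart_map c x) (chart_inv c @^-1` U).
  apply: (chart_inv_continuous Dx); apply: open_nbhs_nbhs.
  by rewrite chart_mapK.
apply: filterS2 Ix Jx => _ [z Dz <-] /=; rewrite chart_mapK// => Uz.
by exists z.
Qed.

Lemma smooth_on_subset (R : realType) (n : nat) (P : smooth_manifold R n)
    (U U' : set P) (F : P -> R) :
  U' `<=` U -> smooth_on U F -> smooth_on U' F.
Proof.
move=> sU sF c ac k; apply: Ck_subset (sF c ac k).
by apply: image_subset; exact: setIS.
Qed.

Lemma smooth_onD (R : realType) (n : nat) (P : smooth_manifold R n)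
    (U : set P) (F G : P -> R) :
  open U -> smooth_on U F -> smooth_on U G -> smooth_on U (F + G).
Proof.
move=> oU sF sG c ac k.
exact: (@CkD _ _ _ k _ (F \o chart_inv c) (G \o chart_inv c)
  (@open_chart_image _ _ _ c _ oU) (sF c ac k) (sG c ac k)).
Qed.

Lemma smooth_onM (R : realType) (n : nat) (P : smooth_manifold R n)
    (U : set P) (F G : P -> R) :
  open U -> smooth_on U F -> smooth_on U G -> smooth_on U (F * G).
Proof.
move=> oU sF sG c ac k.
exact: (@CkM _ _ k _ (F \o chart_inv c) (G \o chart_inv c)
  (@open_chart_image _ _ _ c _ oU) (sF c ac k) (sG c ac k)).
Qed.

Lemma smooth_on_cst (R : realType) (n : nat) (P : smooth_manifold R n)
    (U : set P) (a : R) : smooth_on U (cst a).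
Proof. by move=> c ac k; exact: Ck_cst. Qed.

Lemma smooth_on_setU (R : realType) (n : nat) (P : smooth_manifold R n)
    (U U' : set P) (F : P -> R) :
  smooth_on U F -> smooth_on U' F -> smooth_on (U `|` U') F.
Proof.
move=> sF sF' c ac k; rewrite setIUr image_setU.
by apply: Ck_setU; [exact: sF|exact: sF'].
Qed.

Lemma smooth_on_eq (R : realType) (n : nat) (P : smooth_manifold R n)
    (U : set P) (F G : P -> R) :
  open U -> (forall z, U z -> F z = G z) -> smooth_on U F -> smooth_on U G.
Proof.
move=> oU FG sF c ac k; apply: Ck_ext (sF c ac k); first exact: open_chart_image.
by move=> _ [x [Dx Ux] <-] /=; rewrite chart_mapK//; exact: FG.
Qed.

(** The Euclidean square, unlike the norm of the ambient space of row vectors,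
is a polynomial in the coordinates. *)
Definition sqdist (R : realType) (n : nat) (a x : 'rV[R]_n) : R :=
  \sum_i (x 0 i - a 0 i) ^+ 2.

Lemma Ck_sqdist (R : realType) (V : normedModType R) (n k : nat) (U : set V)
    (a : 'rV[R]_n) (f : V -> 'rV[R]_n) :
  open U -> Ck k U f -> Ck k U (fun x => sqdist a (f x)).
Proof.
move=> oU Cf; apply: Ck_sum => // i.
pose h : V -> R := (fun x => f x 0 i) + cst (- a 0 i).
have -> : (fun x => (f x 0 i - a 0 i) ^+ 2) = h * h.
  by apply/funext => x; rewrite expr2.
have Ch : Ck k U h by apply: CkD => //; [exact: Ck_coord|exact: Ck_cst].
exact: CkM.
Qed.

(** A step function of the squared distance in a chart is supported in the image
[K] of a compact cube.  Hausdorffness makes [K] closed in the whole manifold,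
so extending by 0 outside the chart domain keeps the function smooth. *)
Lemma smooth_bump (R : realType) (n : nat) (P : smooth_manifold R n)
    (m : P) (W : set P) : open W -> W m ->
  exists theta : P -> R, [/\ smooth_on setT theta, \forall z \near m, theta z = 1 &
    exists K, [/\ closed K, K `<=` W & forall z, ~ K z -> theta z = 0]].
Proof.
move=> oW Wm; have [c ac Dm] := atlas_cover m.
set a := chart_map c m.
have : nbhs a (chart_map c @` (chart_dom c `&` W)).
  by apply: open_nbhs_nbhs; split; [exact: open_chart_image|exists m].
move=> /nbhs_ballP[r /= r0 ballr].
pose rho := r / 2; have rho0 : 0 < rho by rewrite divr_gt0.
pose Q := [set v : 'rV[R]_n | forall i, `[a 0 i - rho, a 0 i + rho]%classic (v 0 i)].
have Q_img : Q `<=` chart_map c @` (chart_dom c `&` W).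
  move=> v Qv; apply: ballr; split=> // i j; rewrite [i]ord1 /ball /=.
  have := Qv j; rewrite /= in_itv /= => /andP[h1 h2].
  by rewrite ltr_norml; rewrite /rho in h1 h2; apply/andP; split; lra.
have cQ : compact Q.
  apply: (@rV_compact _ _ (fun i => `[a 0 i - rho, a 0 i + rho]%classic)) => i.
  exact: segment_compact.
pose K := chart_inv c @` Q.
have KDW : K `<=` chart_dom c `&` W.
  by move=> _ [v /Q_img[x [Dx Wx] <-] <-]; rewrite chart_mapK.
have clK : closed K.
  apply: compact_closed; first exact: manifold_hausdorff.
  apply: continuous_compact cQ.
  apply: continuous_subspaceW (chart_inv_cont (c := c)).
  by move=> v /Q_img[x [Dx _] <-]; exists x.
(* Outside the cube some coordinate differs by more than [rho], so the squared
   distance is at least [rho ^+ 2]. *)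
have [g [sg g1 g0]] : exists g : R -> R, [/\ Csmooth setT g,
    forall t, t <= rho ^+ 2 / 2 -> g t = 1 & forall t, rho ^+ 2 <= t -> g t = 0].
  by apply: smooth_step; have := exprn_gt0 2 rho0; lra.
pose theta z := if z \in chart_dom c then g (sqdist a (chart_map c z)) else 0.
have theta_out z : ~ K z -> theta z = 0.
  move=> nKz; rewrite /theta; case: ifPn => //; rewrite inE => Dz.
  apply: g0; rewrite leNgt; apply/negP => lt_rho; apply: nKz.
  exists (chart_map c z); last exact: chart_mapK.
  move=> i; rewrite /= in_itv /=.
  have : (chart_map c z 0 i - a 0 i) ^+ 2 < rho ^+ 2.
    apply: le_lt_trans lt_rho; rewrite /sqdist (bigD1 i)//= lerDl.
    by apply: sumr_ge0 => j _; exact: sqr_ge0.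
  rewrite -subr_gt0 subr_sqr => h.
  by apply/andP; split; nra.
exists theta; split; last by exists K; split=> // z /KDW[].
- move=> d ad k.
  pose U1 := chart_dom d `&` chart_dom c; pose U2 := chart_dom d `&` ~` K.
  apply: (@Ck_subset _ _ _ _ (chart_map d @` U1 `|` chart_map d @` U2)).
    rewrite -image_setU; apply: image_subset => z [Dz _].
    by have [/KDW[Dc _]|nK] := pselect (K z); [left|right].
  apply: Ck_setU.
  + have oU1 : open (chart_map d @` U1).
      by apply: open_chart_image; exact: chart_open_dom.
    apply: (@Ck_ext _ _ _ _ _
      (g \o (fun x => sqdist a ((chart_map c \o chart_inv d) x)))) => //.
      move=> _ [z [Ddz Dcz] <-]; rewrite /theta /= chart_mapK//.
      by rewrite mem_set.
    apply: (@Ck_comp _ _ _ _ g) => //.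
    by apply: Ck_sqdist => //; exact: atlas_compat.
  + apply: (@Ck_ext _ _ _ _ _ (fun=> 0)); last exact: Ck_cst.
      by apply: open_chart_image; exact: closed_openC.
    by move=> _ [z [Dz Kz] <-]; rewrite /= chart_mapK// theta_out.
- have Dn : nbhs m (chart_dom c).
    by apply: open_nbhs_nbhs; split => //; exact: chart_open_dom.
  have csq : {for m, continuous (fun z => sqdist a (chart_map c z))}.
    apply: (@continuous_comp _ _ _ (chart_map c)); first exact: chart_map_continuous.
    have oT : open (setT : set 'rV[R]_n) by exact: openT.
    exact: (Ck_sqdist a oT (@Ck_id R _ 0 setT)).
  have sq0 : sqdist a (chart_map c m) < rho ^+ 2 / 2.
    rewrite /sqdist big1 => [|i _]; last by rewrite subrr expr0n.
    by rewrite divr_gt0// exprn_gt0.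
  have := csq _ (lt_nbhsl sq0) => /=.
  apply: filterS2 Dn => z Dz ltz; rewrite /theta mem_set//.
  by apply: g1; exact: ltW.
Qed.

(** The product of the function with a bump supported in its domain of smoothness
is a witness for the choice made by [global_ext]. *)
Lemma global_extP (R : realType) (n : nat) (P : smooth_manifold R n)
    (m : P) (U : set P) (F : P -> R) :
  open U -> U m -> smooth_on U F -> \forall z \near m, global_ext m F z = F z.
Proof.
move=> oU Um sF.
have [theta [stheta theta1 [K [clK KU theta0]]]] := smooth_bump oU Um.
have sthetaF : smooth_on setT (theta * F).
  have -> : [set: P] = U `|` ~` K.
    apply/esym; rewrite -subTset => z _.
    by have [/KU|] := pselect (K z); [left|right].
  apply: smooth_on_setU.
    by apply: smooth_onM => //; apply: smooth_on_subset stheta.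
  apply: (@smooth_on_eq _ _ _ _ (cst 0)); first exact: closed_openC.
    by move=> z /theta0 tz; change (0 = theta z * F z); rewrite tz mul0r.
  exact: smooth_on_cst.
pose f := SmoothFun (asboolT sthetaF : theta * F \in smooth_pred (P := P)).
apply: (@xgetPex _ 0 [set f : smoothfun P | \forall z \near m, f z = F z]).
exists f => /=; apply: filterS theta1 => z tz.
by change (theta z * F z = F z); rewrite tz mul1r.
Qed.

(** * Tangent vectors act on germs *)

(** Unlike [smooth_on] on a fixed open set, this depends on the germ only, and
functions given on different neighbourhoods can be combined. *)
Definition smooth_at (R : realType) (n : nat) (P : smooth_manifold R n)
    (m : P) (F : P -> R) : Prop :=
  exists U, [/\ open U, U m & smooth_on U F].

Lemma smooth_atD (R : realType) (n : nat) (P : smooth_manifold R n)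
    (m : P) (F G : P -> R) :
  smooth_at m F -> smooth_at m G -> smooth_at m (F + G).
Proof.
move=> [U [oU Um sF]] [U' [oU' U'm sG]]; exists (U `&` U').
have oI : open (U `&` U') by exact: openI.
split=> //; apply: smooth_onD => //; first exact: smooth_on_subset sF.
exact: smooth_on_subset sG.
Qed.

Lemma smooth_atM (R : realType) (n : nat) (P : smooth_manifold R n)
    (m : P) (F G : P -> R) :
  smooth_at m F -> smooth_at m G -> smooth_at m (F * G).
Proof.
move=> [U [oU Um sF]] [U' [oU' U'm sG]]; exists (U `&` U').
have oI : open (U `&` U') by exact: openI.
split=> //; apply: smooth_onM => //; first exact: smooth_on_subset sF.
exact: smooth_on_subset sG.
Qed.

Lemma smooth_at_cst (R : realType) (n : nat) (P : smooth_manifold R n)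
    (m : P) (a : R) : smooth_at m (cst a).
Proof. by exists setT; split=> //; [exact: openT|exact: smooth_on_cst]. Qed.

Lemma smooth_atZ (R : realType) (n : nat) (P : smooth_manifold R n)
    (m : P) (a : R) (F : P -> R) : smooth_at m F -> smooth_at m (a *: F).
Proof. by move=> sF; apply: (smooth_atM (smooth_at_cst m a) sF). Qed.

Lemma global_ext_near (R : realType) (n : nat) (P : smooth_manifold R n)
    (m : P) (F : P -> R) :
  smooth_at m F -> \forall z \near m, global_ext m F z = F z.
Proof. by move=> [U [oU Um sF]]; exact: global_extP sF. Qed.

Lemma tangent_linear (R : realType) (n : nat) (P : smooth_manifold R n)
    (m : P) (v : tangent m) (a : R) (f g : smoothfun P) :
  v (a *: f + g) = a * v f + v g.
Proof. by case: v => v /= /asboolP[lv _]; exact: lv. Qed.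

Lemma tangent_leibniz (R : realType) (n : nat) (P : smooth_manifold R n)
    (m : P) (v : tangent m) (f g : smoothfun P) :
  v (f * g) = v f * g m + f m * v g.
Proof. by case: v => v /= /asboolP[_ Lv]; exact: Lv. Qed.

Lemma tangent0 (R : realType) (n : nat) (P : smooth_manifold R n)
    (m : P) (v : tangent m) : v 0 = 0.
Proof.
have := tangent_linear v 1 0 0; rewrite scaler0 addr0 mul1r => h.
by apply: (addrI (v 0)); rewrite addr0 -h.
Qed.

Lemma tangentB (R : realType) (n : nat) (P : smooth_manifold R n)
    (m : P) (v : tangent m) (f g : smoothfun P) : v (f - g) = v f - v g.
Proof. by rewrite addrC -scaleN1r tangent_linear mulN1r addrC. Qed.

(** A bump [theta] supported where [f = g] satisfies [theta * (f - g) = 0], and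
the Leibniz rule reduces [v (theta * (f - g))] to [v (f - g)]. *)
Lemma tangent_local (R : realType) (n : nat) (P : smooth_manifold R n)
    (m : P) (v : tangent m) (f g : smoothfun P) :
  (\forall z \near m, f z = g z) -> v f = v g.
Proof.
move=> fg; apply/eqP; rewrite -subr_eq0 -tangentB; apply/eqP.
have [theta [stheta theta1 [K [_ KW theta0]]]] :=
  smooth_bump (@open_interior _ [set z | f z = g z]) fg.
pose th := SmoothFun (asboolT stheta : theta \in smooth_pred (P := P)).
have th0 : th * (f - g) = 0.
  apply: val_inj; apply/funext => z; change (theta z * (f z - g z) = 0).
  have [/KW/interior_subset /= ->|/theta0 ->] := pselect (K z).
    by rewrite subrr mulr0.
  by rewrite mul0r.
have := tangent_leibniz v th (f - g); rewrite th0 tangent0.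
have -> : (f - g) m = 0.
  by change (f m - g m = 0); rewrite (nbhs_singleton fg) subrr.
have -> : th m = 1 by exact: (nbhs_singleton theta1).
by rewrite mulr0 add0r mul1r => <-.
Qed.

Lemma tangent_ext_linear (R : realType) (n : nat) (P : smooth_manifold R n)
    (m : P) (v : tangent m) (a : R) (F G : P -> R) :
  smooth_at m F -> smooth_at m G ->
  v (global_ext m (a *: F + G)) = a * v (global_ext m F) + v (global_ext m G).
Proof.
move=> sF sG; rewrite -tangent_linear; apply: tangent_local.
have eFG := global_ext_near (smooth_atD (smooth_atZ a sF) sG).
have eF := global_ext_near sF; have eG := global_ext_near sG.
near=> z.
transitivity ((a *: F + G) z); first by near: z.
change (a * F z + G z = a * global_ext m F z + global_ext m G z).
by congr (_ * _ + _); apply/esym; near: z.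
Unshelve. all: by end_near. Qed.

Lemma tangent_ext_leibniz (R : realType) (n : nat) (P : smooth_manifold R n)
    (m : P) (v : tangent m) (F G : P -> R) :
  smooth_at m F -> smooth_at m G ->
  v (global_ext m (F * G)) =
    v (global_ext m F) * G m + F m * v (global_ext m G).
Proof.
move=> sF sG.
have eFG := global_ext_near (smooth_atM sF sG).
have eF := global_ext_near sF; have eG := global_ext_near sG.
rewrite -(nbhs_singleton eF) -(nbhs_singleton eG) -tangent_leibniz.
apply: tangent_local; near=> z.
transitivity ((F * G) z); first by near: z.
change (F z * G z = global_ext m F z * global_ext m G z).
by congr (_ * _); apply/esym; near: z.
Unshelve. all: by end_near. Qed.

Lemma tangent_ext_cst (R : realType) (n : nat) (P : smooth_manifold R n)
    (m : P) (v : tangent m) (a : R) : v (global_ext m (cst a)) = 0.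
Proof.
have v1 : v 1 = 0.
  have := tangent_leibniz v 1 1; rewrite mulr1.
  have -> : (1 : smoothfun P) m = 1 by [].
  rewrite mulr1 mul1r => h.
  by apply: (addrI (v 1)); rewrite addr0 -h.
transitivity (v (a *: (1 : smoothfun P) + 0)); last first.
  by rewrite tangent_linear v1 tangent0 mulr0 addr0.
apply: tangent_local; have := global_ext_near (smooth_at_cst m a).
by apply: filterS => z ->; change (a = a * 1 + 0); rewrite mulr1 addr0.
Qed.

Lemma bracket_derivation_right (R : realType) (n : nat) (P : smooth_manifold R n)
    (br : leibniz_bracket P) (m : P) (f : smoothfun P) :
  (fun g => br f g m) \in derivation_at m.
Proof.
apply/asboolP; split=> [a g h|g h]; first by rewrite lbracket_linearr.
rewrite lbracket_derr.
change (g m * br f h m + h m * br f g m = br f g m * h m + g m * br f h m).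
by ring.
Qed.

Lemma bracket_derivation_left (R : realType) (n : nat) (P : smooth_manifold R n)
    (br : leibniz_bracket P) (m : P) (g : smoothfun P) :
  (fun f => br f g m) \in derivation_at m.
Proof.
by apply/asboolP; split=> [a f h|f h]; rewrite ?lbracket_linearl ?lbracket_derl.
Qed.

Definition hamiltonian_right (R : realType) (n : nat) (P : smooth_manifold R n)
    (br : leibniz_bracket P) (m : P) (f : smoothfun P) : tangent m :=
  Tangent (bracket_derivation_right br m f).

Definition hamiltonian_left (R : realType) (n : nat) (P : smooth_manifold R n)
    (br : leibniz_bracket P) (m : P) (g : smoothfun P) : tangent m :=
  Tangent (bracket_derivation_left br m g).

Lemma primitiveP (R : realType) (n : nat) (P : smooth_manifold R n)
    (m : P) (alpha : cotangent m) (v : tangent m) : v (primitive alpha) = alpha v.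
Proof. by rewrite /primitive; case: cid => f /= ->. Qed.

(** The primitive of a differential need not have the germ of the original
function, but no tangent vector distinguishes them, and the bracket is a
tangent vector in either entry. *)
Lemma leibniz_tensorE (R : realType) (n : nat) (P : smooth_manifold R n)
    (br : leibniz_bracket P) (m : P) (F G : P -> R) :
  leibniz_tensor br (differential m F) (differential m G) = local_bracket br F G m.
Proof.
rewrite /leibniz_tensor /local_bracket.
have /= -> := primitiveP (differential m F)
  (hamiltonian_left br m (primitive (differential m G))).
by have /= -> := primitiveP (differential m G)
  (hamiltonian_right br m (global_ext m F)).
Qed.

(** The vector minus [br (primitive alpha) _] satisfies the condition defining
[BL], so the arbitrary choice in that definition does too. *)
Lemma BL_P (R : realType) (n : nat) (P : smooth_manifold R n)
    (br : leibniz_bracket P) (m : P) (alpha beta : cotangent m) :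
  beta (BL br m alpha) = - leibniz_tensor br alpha beta.
Proof.
suff /(_ beta) -> : forall beta, leibniz_tensor br alpha beta = - beta (BL br m alpha).
  by rewrite opprK.
apply: (@xgetPex _ 0 [set v : tangent m |
  forall beta, leibniz_tensor br alpha beta = - beta v]).
exists (- hamiltonian_right br m (primitive alpha)) => b /=.
rewrite -primitiveP.
change (leibniz_tensor br alpha b = - - br (primitive alpha) (primitive b) m).
by rewrite opprK.
Qed.

Lemma BR_P (R : realType) (n : nat) (P : smooth_manifold R n)
    (br : leibniz_bracket P) (m : P) (alpha beta : cotangent m) :
  alpha (BR br m beta) = leibniz_tensor br alpha beta.
Proof.
suff /(_ alpha) -> : forall alpha, leibniz_tensor br alpha beta = alpha (BR br m beta).
  by [].
apply: (@xgetPex _ 0 [set v : tangent m |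
  forall alpha, leibniz_tensor br alpha beta = alpha v]).
by exists (hamiltonian_left br m (primitive beta)) => a /=; rewrite -primitiveP.
Qed.

Lemma cotangentD (R : realType) (n : nat) (P : smooth_manifold R n)
    (m : P) (alpha : cotangent m) (v w : tangent m) :
  alpha (v + w) = alpha v + alpha w.
Proof. by rewrite -!primitiveP. Qed.

(** * Algebra of the bracket on germs *)

Lemma local_bracket_linearl (R : realType) (n : nat) (P : smooth_manifold R n)
    (br : leibniz_bracket P) (m : P) (a : R) (F F' G : P -> R) :
  smooth_at m F -> smooth_at m F' ->
  local_bracket br (a *: F + F') G m =
    a * local_bracket br F G m + local_bracket br F' G m.
Proof.
move=> sF sF'.
exact: (tangent_ext_linear (hamiltonian_left br m (global_ext m G)) a sF sF').
Qed.

Lemma local_bracket_linearr (R : realType) (n : nat) (P : smooth_manifold R n)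
    (br : leibniz_bracket P) (m : P) (a : R) (F G G' : P -> R) :
  smooth_at m G -> smooth_at m G' ->
  local_bracket br F (a *: G + G') m =
    a * local_bracket br F G m + local_bracket br F G' m.
Proof.
move=> sG sG'.
exact: (tangent_ext_linear (hamiltonian_right br m (global_ext m F)) a sG sG').
Qed.

Lemma local_bracket_derl (R : realType) (n : nat) (P : smooth_manifold R n)
    (br : leibniz_bracket P) (m : P) (F G H : P -> R) :
  smooth_at m F -> smooth_at m G ->
  local_bracket br (F * G) H m =
    local_bracket br F H m * G m + F m * local_bracket br G H m.
Proof.
move=> sF sG.
exact: (tangent_ext_leibniz (hamiltonian_left br m (global_ext m H)) sF sG).
Qed.

Lemma local_bracket_derr (R : realType) (n : nat) (P : smooth_manifold R n)
    (br : leibniz_bracket P) (m : P) (F G H : P -> R) :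
  smooth_at m G -> smooth_at m H ->
  local_bracket br F (G * H) m =
    G m * local_bracket br F H m + H m * local_bracket br F G m.
Proof.
move=> sG sH.
have := tangent_ext_leibniz (hamiltonian_right br m (global_ext m F)) sG sH.
by rewrite addrC [_ * H m]mulrC.
Qed.

Lemma local_bracket_cstl (R : realType) (n : nat) (P : smooth_manifold R n)
    (br : leibniz_bracket P) (m : P) (a : R) (G : P -> R) :
  local_bracket br (cst a) G m = 0.
Proof. exact: (tangent_ext_cst (hamiltonian_left br m (global_ext m G))). Qed.

Lemma local_bracket_cstr (R : realType) (n : nat) (P : smooth_manifold R n)
    (br : leibniz_bracket P) (m : P) (a : R) (F : P -> R) :
  local_bracket br F (cst a) m = 0.
Proof. exact: (tangent_ext_cst (hamiltonian_right br m (global_ext m F))). Qed.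

(** * Invariant functions and the annihilator condition *)

Lemma inv_nbhsI (R : realType) (n : nat) (P : smooth_manifold R n)
    (A : set (P -> option P)) (m : P) (U U' : set P) :
  inv_nbhs A m U -> inv_nbhs A m U' -> inv_nbhs A m (U `&` U').
Proof.
move=> [oU iU Um] [oU' iU' U'm]; split=> //; first exact: openI.
by move=> a z w Aa [Uz U'z] az; split; [exact: iU az|exact: iU' az].
Qed.

Lemma inv_smooth_subset (R : realType) (n : nat) (P : smooth_manifold R n)
    (A : set (P -> option P)) (U U' : set P) (F : P -> R) :
  U' `<=` U -> inv_smooth A U F -> inv_smooth A U' F.
Proof.
move=> sU [sF iF]; split; first exact: smooth_on_subset sF.
by move=> a z w Aa /sU; exact: iF.
Qed.

Lemma inv_smooth_cst (R : realType) (n : nat) (P : smooth_manifold R n)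
    (A : set (P -> option P)) (U : set P) (a : R) : inv_smooth A U (cst a).
Proof. by split=> //; exact: smooth_on_cst. Qed.

Lemma inv_smoothD (R : realType) (n : nat) (P : smooth_manifold R n)
    (A : set (P -> option P)) (U : set P) (F G : P -> R) :
  open U -> inv_smooth A U F -> inv_smooth A U G -> inv_smooth A U (F + G).
Proof.
move=> oU [sF iF] [sG iG]; split; first exact: smooth_onD.
by move=> a z w Aa Uz az; rewrite !fctE (iF _ _ _ Aa Uz az) (iG _ _ _ Aa Uz az).
Qed.

Lemma inv_smoothM (R : realType) (n : nat) (P : smooth_manifold R n)
    (A : set (P -> option P)) (U : set P) (F G : P -> R) :
  open U -> inv_smooth A U F -> inv_smooth A U G -> inv_smooth A U (F * G).
Proof.
move=> oU [sF iF] [sG iG]; split; first exact: smooth_onM.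
by move=> a z w Aa Uz az; rewrite !fctE (iF _ _ _ Aa Uz az) (iG _ _ _ Aa Uz az).
Qed.

Lemma inv_smooth_at (R : realType) (n : nat) (P : smooth_manifold R n)
    (A : set (P -> option P)) (m : P) (U : set P) (F : P -> R) :
  inv_nbhs A m U -> inv_smooth A U F -> smooth_at m F.
Proof. by move=> [oU _ Um] [sF _]; exists U. Qed.

Lemma inv_nbhs_stab (R : realType) (n : nat) (P : smooth_manifold R n)
    (A : set (P -> option P)) (S : set P) (m : P) (U : set P) :
  inv_nbhs A m U -> inv_nbhs (stab A S) m U.
Proof. by move=> [oU iU Um]; split=> // a z w [Aa _]; exact: iU. Qed.

Lemma inv_smooth_stab (R : realType) (n : nat) (P : smooth_manifold R n)
    (A : set (P -> option P)) (S U : set P) (F : P -> R) :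
  inv_smooth A U F -> inv_smooth (stab A S) U F.
Proof. by move=> [sF iF]; split=> // a z w [Aa _]; exact: iF. Qed.

(** The annihilator condition of the theorem at [m], read on functions. *)
Definition bracket_annihilates (R : realType) (n : nat) (P : smooth_manifold R n)
    (br : leibniz_bracket P) (A : set (P -> option P)) (S : set P)
    (T : set (set P)) (m : P) : Prop :=
  forall U F U' H V c,
    inv_nbhs A m U -> inv_smooth A U F ->
    inv_nbhs A m U' -> inv_smooth A U' H ->
    T V -> invariant_set (stab A S) V -> V m ->
    (forall z, U' z -> V z -> H z = c) ->
  local_bracket br F H m = 0 /\ local_bracket br H F m = 0.

(** The two halves of the vanishing condition are obtained by taking one of the
two summands to be the image of [d0], whose contribution is zero. *)
Lemma annihilator_bracket (R : realType) (n : nat) (P : smooth_manifold R n)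
    (br : leibniz_bracket P) (A : set (P -> option P)) (S : set P)
    (T : set (set P)) (m : P) :
  [set v + w | v in BL br m @` Delta A m & w in BR br m @` Delta A m]
    `<=` annihilator (DeltaS A S T m) <->
  bracket_annihilates br A S T m.
Proof.
split=> [inc U F U' H V c nU sF nU' sH TV iV Vm Hc|van].
  have dF : Delta A m (differential m F) by exists U, F.
  have d0 : Delta A m (differential m (cst 0)).
    by exists U, (cst 0); split=> //; exact: inv_smooth_cst.
  have dH : DeltaS A S T m (differential m H).
    by exists U', H, V; split=> //; exists c.
  split.
  - have : annihilator (DeltaS A S T m)
        (BL br m (differential m F) + BR br m (differential m (cst 0))).
      apply: inc; exists (BL br m (differential m F)).
        by exists (differential m F).
      by exists (BR br m (differential m (cst 0))).
    move=> /(_ _ dH); rewrite cotangentD BL_P BR_P !leibniz_tensorE.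
    by rewrite local_bracket_cstr addr0 => /eqP; rewrite oppr_eq0 => /eqP.
  - have : annihilator (DeltaS A S T m)
        (BL br m (differential m (cst 0)) + BR br m (differential m F)).
      apply: inc; exists (BL br m (differential m (cst 0))).
        by exists (differential m (cst 0)).
      by exists (BR br m (differential m F)).
    move=> /(_ _ dH); rewrite cotangentD BL_P BR_P !leibniz_tensorE.
    by rewrite local_bracket_cstl oppr0 add0r.
move=> _ [_ [_ [U [F [nU sF ->]]] <-] [_ [_ [U1 [G [nU1 sG ->]]] <-] <-]].
move=> _ [U' [H [V [nU' sH -> [TV iV Vm] [c Hc]]]]].
rewrite cotangentD BL_P BR_P !leibniz_tensorE.
have [-> _] := van _ _ _ _ _ _ nU sF nU' sH TV iV Vm Hc.
have [_ ->] := van _ _ _ _ _ _ nU1 sG nU' sH TV iV Vm Hc.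
by rewrite oppr0 addr0.
Qed.

(** * Orbits and local extensions *)

Lemma orbit_eq (R : realType) (n : nat) (P : smooth_manifold R n)
    (A : set (P -> option P)) (a : P -> option P) (z w : P) :
  pseudogroup A -> A a -> a z = Some w -> Defs.orbit A z = Defs.orbit A w.
Proof.
move=> pA Aa az; have [a' [aa' _ _]] := pg_diffeo pA Aa.
have Aa' := pg_inv pA Aa aa'; have a'w := (aa' z w).1 az.
apply/seteqP; split=> p [b Ab bp].
  by exists (pcomp b a'); [exact: pg_comp|rewrite /pcomp a'w].
by exists (pcomp b a); [exact: pg_comp|rewrite /pcomp az].
Qed.

Lemma orbit_refl (R : realType) (n : nat) (P : smooth_manifold R n)
    (A : set (P -> option P)) (z : P) : pseudogroup A -> Defs.orbit A z z.
Proof. by move=> pA; exists Some => //; exact: pg_id. Qed.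

Lemma orbit_point (R : realType) (n : nat) (P : smooth_manifold R n)
    (A : set (P -> option P)) (S : set P) (V : set (set P)) (q : V) :
  V `<=` orbit_space A S ->
  exists m, S m /\ exists Vm : V (Defs.proj A S m), q = at_orbit Vm.
Proof.
move=> VS; have Vq : V (val q) by apply: set_mem; exact: valP.
have [m Sm qm] := VS _ Vq.
have Vm : V (Defs.proj A S m) by rewrite qm.
by exists m; split=> //; exists Vm; apply: val_inj.
Qed.

Lemma invariant_proj_preimage (R : realType) (n : nat) (P : smooth_manifold R n)
    (A : set (P -> option P)) (S : set P) (V : set (set P)) :
  pseudogroup (stab A S) -> invariant_set (stab A S) (proj_preimage A S V).
Proof.
move=> pA a z w Aa [Sz Vz] az; split; first exact: (Aa.2 z w).
by rewrite /preimage /= /Defs.proj -(orbit_eq pA Aa az).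
Qed.

Lemma local_extension_linear (R : realType) (n : nat) (P : smooth_manifold R n)
    (A A' : set (P -> option P)) (S : set P) (V : set (set P)) (k : R)
    (f g : V -> R) (m : P) (U U' : set P) (F G : P -> R) :
  local_extension A S A' f m U F -> local_extension A S A' g m U' G ->
  local_extension A S A' (k *: f + g) m (U `&` U') (k *: F + G).
Proof.
move=> [nU sF fF] [nU' sG gG]; have nI := inv_nbhsI nU nU'.
split=> //; last first.
  move=> z Sz [Uz U'z] Vz.
  change (k * f (at_orbit Vz) + g (at_orbit Vz) = k * F z + G z).
  by rewrite fF// gG.
have [oI _ _] := nI; apply: inv_smoothD => //.
  apply: (inv_smoothM (F := cst k)) => //; first exact: inv_smooth_cst.
  exact: inv_smooth_subset sF.
exact: inv_smooth_subset sG.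
Qed.

Lemma local_extensionM (R : realType) (n : nat) (P : smooth_manifold R n)
    (A A' : set (P -> option P)) (S : set P) (V : set (set P))
    (f g : V -> R) (m : P) (U U' : set P) (F G : P -> R) :
  local_extension A S A' f m U F -> local_extension A S A' g m U' G ->
  local_extension A S A' (f * g) m (U `&` U') (F * G).
Proof.
move=> [nU sF fF] [nU' sG gG]; have nI := inv_nbhsI nU nU'.
split=> //; last first.
  move=> z Sz [Uz U'z] Vz.
  change (f (at_orbit Vz) * g (at_orbit Vz) = F z * G z).
  by rewrite fF// gG.
have [oI _ _] := nI; apply: inv_smoothM => //.
  exact: inv_smooth_subset sF.
exact: inv_smooth_subset sG.
Qed.

Lemma local_extension_value (R : realType) (n : nat) (P : smooth_manifold R n)
    (A A' : set (P -> option P)) (S : set P) (V : set (set P))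
    (f : V -> R) (m : P) (U : set P) (F : P -> R) (Vm : V (Defs.proj A S m)) :
  S m -> local_extension A S A' f m U F -> f (at_orbit Vm) = F m.
Proof. by move=> Sm [[_ _ Um] _]; apply. Qed.

(** A domain of extension is invariant but otherwise arbitrary, so it serves all
its points at once; this is used to move along an orbit. *)
Lemma local_extension_move (R : realType) (n : nat) (P : smooth_manifold R n)
    (A : set (P -> option P)) (S : set P) (V : set (set P))
    (f : V -> R) (m z : P) (U : set P) (F : P -> R) :
  U z -> local_extension A S A f m U F -> local_extension A S A f z U F.
Proof. by move=> Uz [[oU iU _] sF fF]; split. Qed.

(** * The reduced bracket *)

(** The difference of two extensions vanishes on the preimage of [V], an open
invariant subset of [S], so its brackets are zero at [m]; the two entries are
exchanged one after the other. *)
Lemma local_bracket_unique (R : realType) (n : nat) (P : smooth_manifold R n)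
    (br : leibniz_bracket P) (A : set (P -> option P)) (S : set P)
    (T : set (set P)) (V : set (set P)) (f g : V -> R) (m : P)
    (U U1 U' U1' : set P) (F F1 G G1 : P -> R) :
  pseudogroup (stab A S) -> orbit_open A S T V ->
  S m -> V (Defs.proj A S m) -> bracket_annihilates br A S T m ->
  local_extension A S A f m U F -> local_extension A S A f m U1 F1 ->
  local_extension A S A g m U' G -> local_extension A S A g m U1' G1 ->
  local_bracket br F G m = local_bracket br F1 G1 m.
Proof.
move=> pA [VS TV] Sm Vm van eF eF1 eG eG1.
have iV : invariant_set (stab A S) (proj_preimage A S V).
  exact: invariant_proj_preimage.
have Vpm : proj_preimage A S V m by [].
have diff0 (h : V -> R) W W1 H H1 : local_extension A S A h m W H ->
    local_extension A S A h m W1 H1 ->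
    local_extension A S A (0 : V -> R) m (W1 `&` W) (-1 *: H1 + H).
  move=> eH eH1; have := local_extension_linear (-1) eH1 eH.
  by rewrite scaleN1r addNr.
have [nF sF _] := eF; have [nF1 sF1 _] := eF1.
have [nG sG _] := eG; have [nG1 sG1 _] := eG1.
have atF := inv_smooth_at nF sF; have atF1 := inv_smooth_at nF1 sF1.
have atG := inv_smooth_at nG sG; have atG1 := inv_smooth_at nG1 sG1.
transitivity (local_bracket br F1 G m).
  have [nD sD D0] := diff0 _ _ _ _ _ eF eF1.
  have D0' z : (U1 `&` U) z -> proj_preimage A S V z -> (-1 *: F1 + F) z = 0.
    by move=> Uz [Sz Vz]; rewrite -(D0 z Sz Uz Vz).
  have [_] := van _ _ _ _ _ _ nG sG nD sD TV iV Vpm D0'.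
  by rewrite local_bracket_linearl// mulN1r addrC => /eqP; rewrite subr_eq0 => /eqP.
have [nD sD D0] := diff0 _ _ _ _ _ eG eG1.
have D0' z : (U1' `&` U') z -> proj_preimage A S V z -> (-1 *: G1 + G) z = 0.
  by move=> Uz [Sz Vz]; rewrite -(D0 z Sz Uz Vz).
have [+ _] := van _ _ _ _ _ _ nF1 sF1 nD sD TV iV Vpm D0'.
by rewrite local_bracket_linearr// mulN1r addrC => /eqP; rewrite subr_eq0 => /eqP.
Qed.

(** The base point is part of the choice because only the orbit is given. *)
Definition reduced_bracket (R : realType) (n : nat) (P : smooth_manifold R n)
    (br : leibniz_bracket P) (A : set (P -> option P)) (S : set P)
    (V : set (set P)) (f g : V -> R) : V -> R := fun q =>
  xget 0 [set r | exists m U F U' G, [/\ S m, Defs.proj A S m = val q,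
    local_extension A S A f m U F, local_extension A S A g m U' G &
    r = local_bracket br F G m]].

(** The chosen base point [m1] and [m] are related by some [a] of the stabiliser;
the chosen extensions are also extensions at [m], and the invariance of their
bracket under [a] equates its values at the two points. *)
Lemma reduced_bracketE (R : realType) (n : nat) (P : smooth_manifold R n)
    (br : leibniz_bracket P) (A : set (P -> option P)) (S : set P)
    (T : set (set P)) (V : set (set P)) (f g : V -> R) (m : P)
    (Vm : V (Defs.proj A S m)) (U U' : set P) (F G : P -> R) :
  invariants_closed br A -> pseudogroup (stab A S) ->
  orbit_open A S T V -> S m -> bracket_annihilates br A S T m ->
  local_extension A S A f m U F -> local_extension A S A g m U' G ->
  reduced_bracket br A S f g (at_orbit Vm) = local_bracket br F G m.
Proof.
move=> cA pA oV Sm van eF eG; rewrite /reduced_bracket.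
case: xgetP => [r _|/(_ (local_bracket br F G m))]; last first.
  by case; exists m, U, F, U', G.
move=> [m1 [U1 [F1 [U1' [G1 [Sm1 /= qm1 eF1 eG1 ->]]]]]].
have [a sa am] : Defs.orbit (stab A S) m1 m.
  by move: qm1; rewrite /Defs.proj => ->; exact: orbit_refl.
have Aa := sa.1.
have [nF1 sF1 _] := eF1; have [nG1 sG1 _] := eG1.
have nI := inv_nbhsI nF1 nG1.
have sF1' := inv_smooth_subset (@subIsetl _ U1 U1') sF1.
have sG1' := inv_smooth_subset (@subIsetr _ U1 U1') sG1.
have [oI iI Im1] := nI.
have [_ inv_br] := cA _ oI iI _ _ sF1' sG1'.
have [U1m U1'm] := iI _ _ _ Aa Im1 am.
rewrite -(inv_br _ _ _ Aa Im1 am).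
apply: (local_bracket_unique pA oV) => //.
- exact: local_extension_move eF1.
- exact: eF.
- exact: local_extension_move eG1.
- exact: eG.
Qed.

Lemma reducible_of_annihilates (R : realType) (n : nat) (P : smooth_manifold R n)
    (br : leibniz_bracket P) (A : set (P -> option P)) (S : set P)
    (T : set (set P)) :
  invariants_closed br A -> local_extension_property A S T ->
  (forall m, S m -> bracket_annihilates br A S T m) ->
  leibniz_reducible A S T br.
Proof.
move=> cA [pA ext] van.
have bE V f g m (Vm : V (Defs.proj A S m)) U U' F G
    (oV : orbit_open A S T V) (Sm : S m) :=
  @reduced_bracketE R n P br A S T V f g m Vm U U' F G cA pA oV Sm (van m Sm).
have point V (oV : orbit_open A S T V) (q : V) : exists m, S m /\
    exists Vm : V (Defs.proj A S m), q = at_orbit Vm.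
  by apply: orbit_point; case: oV.
have pext V f m (oV : orbit_open A S T V)
    (wf : whitney (V := V) A S f) (Sm : S m)
    (Vm : V (Defs.proj A S m)) : exists U F, local_extension A S A f m U F.
  by apply: ext.
exists (fun V f g => reduced_bracket br A S (V := V) f g); split; last first.
  by move=> V oV f g _ _ m Sm Vm U F U' G eF eG; exact: bE eF eG.
split=> V oV.
- move=> f g wf wg m [Sm Vm].
  have [U [F eF]] := pext V f m oV wf Sm Vm.
  have [U' [G eG]] := pext V g m oV wg Sm Vm.
  have [nF sF _] := eF; have [nG sG _] := eG.
  have nI := inv_nbhsI nF nG.
  exists (U `&` U'), (local_bracket br F G); split.
  + exact: inv_nbhs_stab.
  + apply: inv_smooth_stab; have [oI iI _] := nI.
    apply: cA => //; [exact: inv_smooth_subset sF|exact: inv_smooth_subset sG].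
  + move=> z Sz [Uz U'z] Vz.
    apply: bE => //; [exact: local_extension_move eF|exact: local_extension_move eG].
- move=> k f f' g wf wf' wg; apply/funext => q.
  have [m [Sm [Vm ->]]] := point V oV q.
  have [U [F eF]] := pext V f m oV wf Sm Vm.
  have [U1 [F1 eF1]] := pext V f' m oV wf' Sm Vm.
  have [U' [G eG]] := pext V g m oV wg Sm Vm.
  have [nF sF _] := eF; have [nF1 sF1 _] := eF1.
  rewrite (bE _ _ _ _ _ _ _ _ _ oV Sm (local_extension_linear k eF eF1) eG).
  rewrite local_bracket_linearl; [|exact: inv_smooth_at sF|exact: inv_smooth_at sF1].
  rewrite -(bE _ _ _ _ Vm _ _ _ _ oV Sm eF eG).
  by rewrite -(bE _ _ _ _ Vm _ _ _ _ oV Sm eF1 eG).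
- move=> k f g g' wf wg wg'; apply/funext => q.
  have [m [Sm [Vm ->]]] := point V oV q.
  have [U [F eF]] := pext V f m oV wf Sm Vm.
  have [U' [G eG]] := pext V g m oV wg Sm Vm.
  have [U1 [G1 eG1]] := pext V g' m oV wg' Sm Vm.
  have [nG sG _] := eG; have [nG1 sG1 _] := eG1.
  rewrite (bE _ _ _ _ _ _ _ _ _ oV Sm eF (local_extension_linear k eG eG1)).
  rewrite local_bracket_linearr; [|exact: inv_smooth_at sG|exact: inv_smooth_at sG1].
  rewrite -(bE _ _ _ _ Vm _ _ _ _ oV Sm eF eG).
  by rewrite -(bE _ _ _ _ Vm _ _ _ _ oV Sm eF eG1).
- move=> f g h wf wg wh; apply/funext => q.
  have [m [Sm [Vm ->]]] := point V oV q.
  have [U [F eF]] := pext V f m oV wf Sm Vm.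
  have [U' [G eG]] := pext V g m oV wg Sm Vm.
  have [U1 [H eH]] := pext V h m oV wh Sm Vm.
  have [nF sF _] := eF; have [nG sG _] := eG.
  rewrite (bE _ _ _ _ _ _ _ _ _ oV Sm (local_extensionM eF eG) eH).
  rewrite local_bracket_derl; [|exact: inv_smooth_at sF|exact: inv_smooth_at sG].
  rewrite -(bE _ _ _ _ Vm _ _ _ _ oV Sm eF eH) -(bE _ _ _ _ Vm _ _ _ _ oV Sm eG eH).
  by rewrite -(local_extension_value Vm Sm eF) -(local_extension_value Vm Sm eG).
- move=> f g h wf wg wh; apply/funext => q.
  have [m [Sm [Vm ->]]] := point V oV q.
  have [U [F eF]] := pext V f m oV wf Sm Vm.
  have [U' [G eG]] := pext V g m oV wg Sm Vm.
  have [U1 [H eH]] := pext V h m oV wh Sm Vm.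
  have [nG sG _] := eG; have [nH sH _] := eH.
  rewrite (bE _ _ _ _ _ _ _ _ _ oV Sm eF (local_extensionM eG eH)).
  rewrite local_bracket_derr; [|exact: inv_smooth_at sG|exact: inv_smooth_at sH].
  rewrite -(bE _ _ _ _ Vm _ _ _ _ oV Sm eF eG) -(bE _ _ _ _ Vm _ _ _ _ oV Sm eF eH).
  by rewrite -(local_extension_value Vm Sm eG) -(local_extension_value Vm Sm eH).
Qed.

(** The bracket with [H] is compared with the bracket with the constant [c], which
extends the same function on the quotient of the common domain [X]. *)
Lemma annihilates_of_reducible (R : realType) (n : nat) (P : smooth_manifold R n)
    (br : leibniz_bracket P) (A : set (P -> option P)) (S : set P)
    (T : set (set P)) (m : P) :
  topology_on S T -> stronger_than_relative S T -> pseudogroup (stab A S) ->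
  leibniz_reducible A S T br -> S m -> bracket_annihilates br A S T m.
Proof.
move=> [TS _ TI _] sT pA [b [_ bE]] Sm U F U' H W c nF sF nH sH TW iW Wm Hc.
have nI := inv_nbhsI nF nH; have [oI iI Im] := nI.
(* [X] is saturated, so it is the full preimage of its image in the quotient. *)
pose X := U `&` U' `&` W.
have TX : T X.
  have -> : X = (U `&` U' `&` S) `&` W.
    by rewrite /X -(setIA _ S) (setIidr (A := S)) //; exact: TS.
  by apply: TI => //; exact: sT.
have XS : X `<=` S by exact: TS.
have iX : invariant_set (stab A S) X.
  move=> a z w sa [Iz Wz] az; split; last exact: iW az.
  exact: iI sa.1 Iz az.
pose V := Defs.proj A S @` X.
have memX z : V (Defs.proj A S z) -> X z.
  move=> [x Xx xz]; have [a sa ax] : Defs.orbit (stab A S) x z.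
    by move: xz; rewrite /Defs.proj => ->; exact: orbit_refl.
  exact: iX sa Xx ax.
have oV : orbit_open A S T V.
  split; first by move=> _ [x Xx <-]; exists x => //; exact: XS.
  suff -> : proj_preimage A S V = X by [].
  apply/seteqP; split=> z; first by move=> [_ /memX].
  by move=> Xz; split; [exact: XS|exists z].
have Vm : V (Defs.proj A S m) by exists m.
(* A section of the projection: [F] is constant on the orbits inside [X]. *)
pose rep (q : V) : P := sval (cid2 (set_mem (valP q))).
have repX (q : V) : X (rep q) by rewrite /rep; case: cid2.
have repE (q : V) : Defs.proj A S (rep q) = val q by rewrite /rep; case: cid2.
pose f : V -> R := F \o rep.
have eF : local_extension A S A f m U F.
  split=> // z Sz Uz Vz.
  have [a sa az] : Defs.orbit (stab A S) z (rep (at_orbit Vz)).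
    have -> : Defs.orbit (stab A S) z = Defs.orbit (stab A S) (rep (at_orbit Vz)).
      by rewrite -[RHS]/(Defs.proj A S _) repE.
    exact: orbit_refl.
  by have [_ iF] := sF; exact: iF sa.1 Uz az.
have eH : local_extension A S A (cst c : V -> R) m U' H.
  by split=> // z Sz U'z Vz; have [_ Wz] := memX z Vz; rewrite Hc.
have ec : local_extension A S A (cst c : V -> R) m U' (cst c).
  by split=> //; exact: inv_smooth_cst.
have wh (h : V -> R) Y K : local_extension A S A h m Y K -> X `<=` Y -> whitney A S h.
  move=> [nK sK hK] XY x [Sx /memX Xx]; exists Y, K; split.
  - by apply: inv_nbhs_stab; have [oY iY _] := nK; split=> //; exact: XY.
  - exact: inv_smooth_stab.
  - exact: hK.
have wf : whitney A S f by apply: wh eF _ => z [[]].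
have wc : whitney A S (cst c : V -> R) by apply: wh eH _ => z [[]].
split.
  rewrite -(bE V oV _ _ wf wc m Sm Vm _ _ _ _ eF eH).
  by rewrite (bE V oV _ _ wf wc m Sm Vm _ _ _ _ eF ec) local_bracket_cstr.
rewrite -(bE V oV _ _ wc wf m Sm Vm _ _ _ _ eH eF).
by rewrite (bE V oV _ _ wc wf m Sm Vm _ _ _ _ ec eF) local_bracket_cstl.
Qed.

Theorem theorem6p5 (R : realType) (n : nat) (P : smooth_manifold R n)
    (br : leibniz_bracket P) (A : set (P -> option P))
    (S : set P) (T : set (set P)) :
  pseudogroup A ->
  invariants_closed br A ->
  topology_on S T ->
  stronger_than_relative S T ->
  local_extension_property A S T ->
  (leibniz_reducible A S T br <->
   forall m : P, S m ->
     [set v + w | v in BL br m @` Delta A m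
                & w in BR br m @` Delta A m]
       `<=` annihilator (DeltaS A S T m)).
Proof.
move=> _ cA tT sT ext; split=> [red m Sm|inc].
  by apply/annihilator_bracket; apply: annihilates_of_reducible red Sm => //; case: ext.
apply: reducible_of_annihilates => // m Sm.
by apply/annihilator_bracket; exact: inc.
Qed.
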